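(* Consider $\mathbb{R}^n$ equipped with the $\ell_p$-norm $\|\cdot\|_p$, where $1<p\le2$. Let $\Omega=\{x\in\mathbb{R}^n\mid\|x\|_p\le R\}$ be the closed ball centered at the origin with radius $R>0$. Then for every point $x_0\notin\Omega$, there exist a bounded neighborhood $U$ of $x_0$ with $U\cap\Omega=\emptyset$ and a constant $\sigma>0$ such that the distance function $d_\Omega$ is $\sigma$-strongly quasiconvex on $U$.
   Context: The distance function is taken with respect to the $\ell_p$-norm: $d_\Omega(x)=\inf\{\|x-y\|_p\mid y\in\Omega\}$. Let $C\subset\mathbb{R}^n$ be a nonempty convex set and $\sigma>0$. A function $f\colon C\to[-\infty,\infty]$ is $\sigma$-strongly quasiconvex on $C$ if $$f(\lambda x+(1-\lambda)y)\le\max\{f(x),f(y)\}-\frac{\sigma}{2}\lambda(1-\lambda)\|x-y\|_2^2$$ for all $x,y\in C$ and all $\lambda\in(0,1)$, where $\|\cdot\|_2$ is the Euclidean norm regardless of $p$. The notion is defined only on convex sets, so saying that a function is $\sigma$-strongly quasiconvex on $U$ includes the assertion that $U$ is convex. *)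

(* Defs.v *)
From mathcomp Require Import all_boot all_order all_algebra.
From mathcomp Require Import all_classical all_reals all_analysis.

Set Implicit Arguments.
Unset Strict Implicit.
Unset Printing Implicit Defensive.

Import Order.TTheory GRing.Theory Num.Theory.
Import numFieldNormedType.Exports.

Local Open Scope classical_set_scope.
Local Open Scope ring_scope.

(* The canonical norm of 'rV[R]_n is the sup norm, hence this explicit one.
   It is meant for 1 <= p; lpnorm 2 is the Euclidean norm. *)
Definition lpnorm (R : realType) (n : nat) (p : R) (x : 'rV[R]_n) : R :=
  (\sum_(i < n) `|x ord0 i| `^ p) `^ p^-1.

Definition lpball (R : realType) (n : nat) (p r : R) : set 'rV[R]_n :=
  [set x | lpnorm p x <= r].

Definition lpdist (R : realType) (n : nat) (p : R) (A : set 'rV[R]_n)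
    (x : 'rV[R]_n) : \bar R :=
  ereal_inf [set (lpnorm p (x - y))%:E | y in A].

(* The function is total, but only its values on C matter. *)
Definition strongly_quasiconvex (R : realType) (n : nat) (sigma : R)
    (C : set 'rV[R]_n) (f : 'rV[R]_n -> \bar R) : Prop :=
  [/\ C !=set0,
      convex_set C,
      0 < sigma &
      forall (x y : 'rV[R]_n) (lambda : R),
        C x -> C y -> 0 < lambda < 1 ->
        (f (lambda *: x + (1 - lambda) *: y)%R <=
         Order.max (f x) (f y) -
         (sigma / 2 * lambda * (1 - lambda) * lpnorm 2 (x - y) ^+ 2)%:E)%E].

(* Main.v *)
(* Outside the ball the distance is the norm minus r, so only the norm matters.
   For 1 < p <= 2 the scalar function |t|^p is strongly convex on [-M, M], since
   its second derivative p (p - 1) |t|^(p - 2) is at least p (p - 1) M^(p - 2)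
   there. Summing over the coordinates makes the p-th power of the norm strongly
   convex on {N <= M}, and t |-> t^(1/p) has slope at least 1 / (p M^(p - 1)) on
   [0, M^p], which gives the norm the modulus sigma = (p - 1) / M. *)
Require Import Defs.
From mathcomp Require Import all_boot all_order all_algebra.
From mathcomp Require Import all_classical all_reals all_analysis.
From mathcomp Require Import ring lra.

Import Order.TTheory GRing.Theory Num.Theory.
Import numFieldNormedType.Exports.

Local Open Scope classical_set_scope.
Local Open Scope ring_scope.

(** * Real powers: mean value form and monotonicity *)

Lemma powR_MVT (R : realType) (q a b : R) : 0 < a -> a <= b ->
  exists2 c, c \in `[a, b] & b `^ q - a `^ q = q * c `^ (q - 1) * (b - a).
Proof.
move=> a0 ab.
apply: (@MVT_segment _ (@powR R ^~ q) (fun x => q * x `^ (q - 1))) => //.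
  by move=> x; rewrite in_itv => /andP[ax _]; apply/is_derive1_powR/(lt_trans a0).
apply: derivable_within_continuous => x; rewrite in_itv => /andP[ax _].
by apply: derivable_powR; rewrite in_itv/= andbT (lt_le_trans a0).
Qed.

Lemma ler_powR2 (R : realType) (p a b : R) : 0 < p -> 0 <= a -> 0 <= b ->
  (a `^ p <= b `^ p) = (a <= b).
Proof.
move=> p0 a0 b0; apply/idP/idP; last by apply: ge0_ler_powR; rewrite ?nnegrE// ltW.
by apply: contraTT; rewrite -!ltNge; apply: gt0_ltr_powR.
Qed.

(** * The scalar function |t|^p on [-M, M] *)

Section scalar.
Context (R : realType) (p M : R) (hp : 1 < p <= 2) (M0 : 0 < M).

Let p1 : 0 < p - 1.
Proof. by case/andP: hp; rewrite subr_gt0. Qed.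

Let p1_ge0 : 0 <= p - 1 := ltW p1.

Let p2 : p <= 2.
Proof. by case/andP: hp. Qed.

Let p0 : 0 < p.
Proof. by rewrite -(subrK 1 p) addr_gt0. Qed.

Lemma powRB2_lower (t : R) : 0 < t <= M -> M `^ (p - 2) <= t `^ (p - 2).
Proof.
move=> /andP[t0 tM]; rewrite -(opprB 2) !powRN lef_pV2 ?posrE ?powR_gt0 //.
by apply: ge0_ler_powR; rewrite ?nnegrE ?subr_ge0 // ltW.
Qed.

(** The extra factor t admits the endpoint t = 0, where [powRB2_lower] would fail for p < 2 because
    0^(p - 2) is 0 by convention. *)
Lemma powRB1_lower (t : R) : 0 <= t <= M -> M `^ (p - 2) * t <= t `^ (p - 1).
Proof.
case/andP; rewrite le_eqVlt => /predU1P[<- _|t0 tM].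
  by rewrite mulr0 powR_ge0.
rewrite -(mulr_powRB1 (ltW t0) p1) mulrC ler_pM2l//.
rewrite (_ : p - 1 - 1 = p - 2); last by ring.
by apply: powRB2_lower; rewrite t0.
Qed.

Lemma powRB1_increment (s t : R) : 0 < s -> s <= t -> t <= M ->
  (p - 1) * M `^ (p - 2) * (t - s) <= t `^ (p - 1) - s `^ (p - 1).
Proof.
move=> s0 st tM; have [c] := powR_MVT _ (p - 1) _ _ s0 st.
rewrite in_itv/= => /andP[sc ct] ->.
apply: ler_wpM2r; first by rewrite subr_ge0.
rewrite ler_pM2l// (_ : p - 1 - 1 = p - 2); last by ring.
by apply: powRB2_lower; rewrite (lt_le_trans s0 sc) (le_trans ct tM).
Qed.

(** Half the lower bound on the second derivative of t^p over (0, M]. *)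
Let k := p * (p - 1) / 2 * M `^ (p - 2).

(** Subtracting k x^2 from x^p leaves a function [f] whose derivative is still nondecreasing on (0,
    M], so [f] lies above its tangents there; the leftover squares combine into k (s - t)^2. *)
Lemma powR_tangent_pos (s t : R) : 0 < s <= M -> 0 < t <= M ->
  t `^ p + p * t `^ (p - 1) * (s - t) + k * (s - t) ^+ 2 <= s `^ p.
Proof.
pose f : R -> R := @powR R ^~ p \- (fun x => k * x ^+ 2).
pose df x : R := p * x `^ (p - 1) - k * (2 * x).
have fdf (x : R) : 0 < x -> is_derive x 1 f (df x).
  move=> x0; rewrite /f /df.
  have h := @is_derive1_powR _ p _ x0.
  have h2 : is_derive x (1:R) (fun x : R => k * x ^+ 2) (k * (2 * x)).
    by apply: is_derive_eq; rewrite /GRing.scale/=; ring.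
  exact: is_deriveB.
have MVTf (a b : R) : 0 < a -> a <= b ->
    exists2 c, c \in `[a, b] & f b - f a = df c * (b - a).
  move=> a0 ab; apply: MVT_segment => //.
    by move=> x; rewrite in_itv => /andP[ax _]; apply/fdf/(lt_trans a0).
  apply: derivable_within_continuous => x; rewrite in_itv => /andP[ax _].
  by have [] := fdf x (lt_le_trans a0 ax).
have dfle (a b : R) : 0 < a -> a <= b -> b <= M -> df a <= df b.
  move=> a0 ab bM; have := powRB1_increment _ _ a0 ab bM.
  rewrite -(ler_pM2l p0) /df /k; lra.
move=> /andP[s0 sM] /andP[t0 tM].
suff : df t * (s - t) <= f s - f t by rewrite /df /f /=; lra.
have [ts|/ltW st] := leP t s.
  have [c] := MVTf t s t0 ts; rewrite in_itv/= => /andP[tc cs] ->.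
  by apply: ler_wpM2r; [rewrite subr_ge0|apply: dfle => //; exact: le_trans sM].
have [c] := MVTf s t s0 st; rewrite in_itv/= => /andP[sc ct].
have := dfle c t (lt_le_trans s0 sc) ct tM.
move=> /(ler_wpM2r (_ : 0 <= t - s)); rewrite subr_ge0 => /(_ st); lra.
Qed.

(** The derivative argument needs s, t > 0. The cases t = 0 and s = 0 are checked directly, and a
    negative s is reduced to |s|. *)
Lemma powR_tangent (s t : R) : `|s| <= M -> 0 <= t <= M ->
  t `^ p + p * t `^ (p - 1) * (s - t) + k * (s - t) ^+ 2 <= `|s| `^ p.
Proof.
move=> sM /andP[t0 tM].
have K0 : 0 <= M `^ (p - 2) by exact: powR_ge0.
have quad (u : R) : 0 <= u <= M -> M `^ (p - 2) * u ^+ 2 <= u `^ p.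
  move=> /[dup] uM /andP[u0 _]; rewrite -(mulr_powRB1 u0 p0) expr2 mulrCA.
  exact/ler_wpM2l/powRB1_lower.
have tangent_abs : t `^ p + p * t `^ (p - 1) * (`|s| - t) + k * (`|s| - t) ^+ 2
    <= `|s| `^ p.
  (* At t = 0 the claim is k s^2 <= |s|^p; it follows from [quad] because p (p - 1) / 2 <= 1. *)
  have [->|tn0] := eqVneq t 0.
    rewrite powR0 ?gt_eqF// powR0 ?gt_eqF// !mulr0 mul0r !add0r subr0.
    apply: le_trans (quad _ _); last by rewrite normr_ge0.
    apply: ler_wpM2r; first exact: sqr_ge0.
    rewrite /k -[leRHS]mul1r; apply: ler_wpM2r => //.
    (* 2 - p (p - 1) = (2 - p) (p + 1) *)
    have : 0 <= (2 - p) * (p + 1) by rewrite mulr_ge0 ?subr_ge0 ?addr_ge0// ltW.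
    lra.
  (* At s = 0 the claim is k t^2 <= (p - 1) t^p; it follows from [quad] because p / 2 <= 1. *)
  have [->|sn0] := eqVneq s 0.
    rewrite normr0 powR0 ?gt_eqF//.
    have := quad t; rewrite t0 => /(_ tM).
    rewrite -(mulr_powRB1 t0 p0) /k; set K := _ `^ (p - 2); set T := _ `^ _ => h.
    have : 0 <= (p - 1) * (t * T - K * t ^+ 2) + (p - 1) * (2 - p) / 2 * (K * t ^+ 2).
      by rewrite addr_ge0// !mulr_ge0// ?sqr_ge0// subr_ge0.
    lra.
  by apply: powR_tangent_pos; rewrite ?normr_gt0 ?sn0 ?lt0r ?tn0 ?t0.
have [s0|s0] := leP 0 s; first by move: tangent_abs; rewrite ger0_norm.
apply: le_trans tangent_abs; rewrite ltr0_norm//.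
have := powRB1_lower t; rewrite t0 => /(_ tM).
rewrite /k; set K := _ `^ (p - 2); set T := _ `^ _ => h.
(* Twice this quantity is the amount by which the left-hand side drops when -s = |s| is replaced by
   s. *)
have : 0 <= p * (- s) * ((T - K * t) + (2 - p) * (K * t)).
  apply: mulr_ge0; first by rewrite mulr_ge0 ?oppr_ge0// ltW.
  by rewrite addr_ge0 ?subr_ge0// !mulr_ge0// subr_ge0.
lra.
Qed.

(** Average the tangent inequalities at z = l a + (1 - l) b: the linear terms cancel, and the
    quadratic ones add up since l (1 - l)^2 + (1 - l) l^2 = l (1 - l). *)
Lemma powR_strongly_convex (a b l : R) :
  `|a| <= M -> `|b| <= M -> 0 < l < 1 ->
  `|l * a + (1 - l) * b| `^ p <=
  l * `|a| `^ p + (1 - l) * `|b| `^ p - k * l * (1 - l) * (a - b) ^+ 2.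
Proof.
move=> + + /andP[l0 l1].
(* [powR_tangent] requires a nonnegative base point; replacing (a, b) by (-a, -b) arranges this. *)
wlog z0 : a b / 0 <= l * a + (1 - l) * b => [wlog_ge0|] aM bM.
  have [z0|z0] := leP 0 (l * a + (1 - l) * b); first exact: wlog_ge0.
  have := wlog_ge0 (- a) (- b); rewrite !normrN !mulrN -opprD normrN oppr_ge0 (ltW z0).
  have -> : (- a - - b) ^+ 2 = (a - b) ^+ 2 by ring.
  exact.
rewrite (ger0_norm z0); set z := l * a + (1 - l) * b.
have l1_ge0 : 0 <= 1 - l by rewrite subr_ge0 ltW.
have zM : 0 <= z <= M.
  rewrite z0 /=; have -> : M = l * M + (1 - l) * M by ring.
  by apply: lerD; apply: ler_wpM2l; rewrite ?(ltW l0)// (le_trans (ler_norm _)).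
have := ler_wpM2l (ltW l0) (powR_tangent _ _ aM zM).
have := ler_wpM2l l1_ge0 (powR_tangent _ _ bM zM).
rewrite /z; set T := _ `^ (p - 1); set Z := _ `^ p; lra.
Qed.

(** Takes p-th roots: the tangent at m gives m^p - a^p <= p M^(p - 1) (m - a), and k / (p M^(p - 1))
    = (p - 1) / (2 M). *)
Lemma powR_le_sub_drop (a m d : R) : 0 <= a -> 0 <= m <= M -> 0 <= d ->
  a `^ p <= m `^ p - k * d -> a <= m - (p - 1) / M / 2 * d.
Proof.
move=> a0 /andP[m0 mM] d0 am.
have k0 : 0 <= k by rewrite /k mulr_ge0 ?powR_ge0// divr_ge0// mulr_ge0// ltW.
have kd0 : 0 <= k * d by rewrite mulr_ge0.
have alem : a <= m by rewrite -(ler_powR2 _ _ _ _ p0)//; lra.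
have := powR_tangent a m; rewrite ger0_norm// (le_trans alem mM) m0 mM.
move=> /(_ isT isT) tgt.
have ka0 : 0 <= k * (a - m) ^+ 2 by rewrite mulr_ge0 ?sqr_ge0.
have : p * m `^ (p - 1) * (m - a) <= p * M `^ (p - 1) * (m - a).
  rewrite ler_wpM2r ?subr_ge0// ler_wpM2l// ?ler_powR2//; first exact: ltW.
  exact: ltW.
move=> slope.
have P0 : 0 < p * M `^ (p - 1) by rewrite mulr_gt0 ?powR_gt0.
have kE : k = p * M `^ (p - 1) * ((p - 1) / M / 2).
  rewrite /k -(mulr_powRB1 (ltW M0) p1).
  rewrite (_ : p - 1 - 1 = p - 2); last by ring.
  by field; rewrite gt_eqF.
have : k * d <= p * M `^ (p - 1) * (m - a) by lra.
by rewrite kE -mulrA ler_pM2l//; lra.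
Qed.

(** The average of a^p and b^p is at most the p-th power of their maximum, from which the drop is
    then measured. *)
Lemma powR_quasiconvex (a b c d l : R) :
  0 <= a -> a <= M -> 0 <= b -> b <= M -> 0 <= c -> 0 <= d -> 0 < l < 1 ->
  c `^ p <= l * a `^ p + (1 - l) * b `^ p - k * l * (1 - l) * d ->
  c <= Num.max a b - (p - 1) / M / 2 * l * (1 - l) * d.
Proof.
move=> a0 aM b0 bM c0 d0 /andP[l0 l1] cab; set m := Num.max a b.
have am : a <= m by rewrite le_max lexx.
have bm : b <= m by rewrite le_max lexx orbT.
have mM : m <= M by rewrite ge_max aM.
have m0 : 0 <= m := le_trans a0 am.
have l1_ge0 : 0 <= 1 - l by rewrite subr_ge0 ltW.
have -> : (p - 1) / M / 2 * l * (1 - l) * d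
    = (p - 1) / M / 2 * (l * (1 - l) * d) by rewrite !mulrA.
apply: powR_le_sub_drop; rewrite ?m0//.
  by rewrite mulr_ge0// mulr_ge0// ltW.
rewrite !mulrA; apply: le_trans cab _; rewrite lerD2r.
have -> : m `^ p = l * m `^ p + (1 - l) * m `^ p by ring.
by apply: lerD; apply: ler_wpM2l; rewrite ?(ltW l0)// ler_powR2.
Qed.

End scalar.

(** * The p-norm for p > 0, and its comparison with the sup norm *)

Section lpnorm_gt0.
Context (R : realType) (n : nat) (p : R) (p0 : 0 < p).
Implicit Types x y : 'rV[R]_n.

Lemma lpnorm_ge0 x : 0 <= lpnorm p x.
Proof. exact: powR_ge0. Qed.

Lemma powR_lpnorm x : lpnorm p x `^ p = \sum_(i < n) `|x ord0 i| `^ p.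
Proof.
rewrite /lpnorm -powRrM mulVf ?gt_eqF// powRr1//.
by apply: sumr_ge0 => i _; exact: powR_ge0.
Qed.

Lemma normr_coord_le_lpnorm x i : `|x ord0 i| <= lpnorm p x.
Proof.
rewrite -(ler_powR2 _ _ _ _ p0) ?lpnorm_ge0// powR_lpnorm (bigD1 i)//= lerDl.
by apply: sumr_ge0 => j _; exact: powR_ge0.
Qed.

Lemma lpnorm0_eq0 x : lpnorm p x = 0 -> x = 0.
Proof.
move=> x0; apply/rowP => i; rewrite mxE; apply/normr0_eq0/eqP.
by rewrite eq_le normr_ge0 andbT -x0 normr_coord_le_lpnorm.
Qed.

Lemma lpnormZ (c : R) x : lpnorm p (c *: x) = `|c| * lpnorm p x.
Proof.
apply: (powR_injective p0); rewrite ?nnegrE ?mulr_ge0 ?lpnorm_ge0//.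
rewrite powRM ?lpnorm_ge0// !powR_lpnorm mulr_sumr; apply: eq_bigr => i _.
by rewrite mxE normrM powRM.
Qed.

Lemma lpnormN x : lpnorm p (- x) = lpnorm p x.
Proof. by rewrite -scaleN1r lpnormZ normrN1 mul1r. Qed.

Lemma lpnorm0 : lpnorm p (0 : 'rV[R]_n) = 0.
Proof. by rewrite -(scale0r 0) lpnormZ normr0 mul0r. Qed.

Lemma nbhs_lpnorm_lt (x0 : 'rV[R]_n) (e : R) : 0 < e ->
  nbhs x0 [set x | lpnorm p (x - x0) < e].
Proof.
move=> e0; have n0 : 0 < n.+1%:R `^ p^-1 :> R by exact: powR_gt0.
(* Neighborhoods come from the sup norm. With this radius each of the n terms is at most e^p / (n +
   1), so the sum stays strictly below e^p, and n = 0 causes no division by zero. *)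
apply/nbhs_ballP; exists (e / n.+1%:R `^ p^-1) => /=; first exact: divr_gt0.
move=> x [_ x0x] /=.
rewrite ltNge -(ler_powR2 _ _ _ _ p0) ?lpnorm_ge0 ?(ltW e0)// -ltNge powR_lpnorm.
apply: (@le_lt_trans _ _ (\sum_(i < n) e `^ p / n.+1%:R)).
  apply: ler_sum => i _.
  have -> : e `^ p / n.+1%:R = (e / n.+1%:R `^ p^-1) `^ p.
    apply: (canLR (mulfK _)); first by rewrite pnatr_eq0.
    have {2}-> : n.+1%:R = (n.+1%:R `^ p^-1) `^ p :> R.
      by rewrite -powRrM mulVf ?gt_eqF// powRr1.
    by rewrite -powRM ?divfK ?gt_eqF// ?divr_ge0// ltW.
  rewrite (ler_powR2 _ _ _ _ p0) ?divr_ge0 ?(ltW e0) ?(ltW n0)//.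
  by have /ltW := x0x ord0 i; rewrite !mxE distrC.
rewrite sumr_const card_ord -[_ *+ n]mulr_natr mulrAC -mulrA gtr_pMr ?powR_gt0//.
by rewrite ltr_pdivrMr// mul1r ltr_nat.
Qed.

Lemma bounded_lpnorm (A : set 'rV[R]_n) (M : R) :
  (forall x, A x -> lpnorm p x <= M) -> bounded_set A.
Proof.
move=> AM; exists M; split; first exact: num_real.
move=> M' MM' x Ax /=.
have M'0 : 0 <= M' by rewrite ltW// (le_lt_trans _ MM')// (le_trans _ (AM _ Ax))// lpnorm_ge0.
rewrite [leLHS]mx_normrE; apply/bigmax_leP; split => // -[i j] _ /=.
rewrite (ord1 i); apply: le_trans (normr_coord_le_lpnorm _ _) _.
exact/(le_trans (AM _ Ax))/ltW.
Qed.

End lpnorm_gt0.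

Lemma sqr_lpnorm2 (R : realType) (n : nat) (x : 'rV[R]_n) :
  lpnorm 2 x ^+ 2 = \sum_(i < n) x ord0 i ^+ 2.
Proof.
rewrite -powR_mulrn ?lpnorm_ge0// powR_lpnorm//; apply: eq_bigr => i _.
by rewrite powR_mulrn// real_normK// num_real.
Qed.

(** * Strong quasiconvexity of the p-norm, triangle inequality and distance to the ball *)

Section lpnorm_le2.
Context (R : realType) (n : nat) (p : R) (hp : 1 < p <= 2).
Implicit Types x y : 'rV[R]_n.

Let p1 : 0 < p - 1.
Proof. by case/andP: hp; rewrite subr_gt0. Qed.

Let p0 : 0 < p.
Proof. by rewrite -(subrK 1 p) addr_gt0. Qed.

Local Notation N := (@lpnorm R n p).

Lemma powR_lpnorm_strongly_convex (M l : R) x y :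
  0 < M -> N x <= M -> N y <= M -> 0 < l < 1 ->
  N (l *: x + (1 - l) *: y) `^ p <= l * N x `^ p + (1 - l) * N y `^ p
    - p * (p - 1) / 2 * M `^ (p - 2) * l * (1 - l) * lpnorm 2 (x - y) ^+ 2.
Proof.
move=> M0 xM yM hl; pose S (z : 'rV[R]_n) := \sum_(i < n) `|z ord0 i| `^ p.
(* Rewriting with powR_lpnorm in place diverges: unification unfolds lpnorm. *)
have main a b c : a = S x -> b = S y -> c = S (l *: x + (1 - l) *: y) ->
    c <= l * a + (1 - l) * b
      - p * (p - 1) / 2 * M `^ (p - 2) * l * (1 - l) * lpnorm 2 (x - y) ^+ 2.
  move=> -> -> ->; rewrite /S sqr_lpnorm2 2!mulr_sumr mulr_sumr.
  rewrite -big_split/= -sumrB; apply: ler_sum => i _; rewrite !mxE.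
  have coord (v : 'rV[R]_n) : N v <= M -> `|v ord0 i| <= M.
    exact/le_trans/normr_coord_le_lpnorm.
  exact: (powR_strongly_convex _ _ _ hp M0 _ _ _ (coord _ xM) (coord _ yM) hl).
by apply: main; exact: powR_lpnorm.
Qed.

Lemma lpnorm_strongly_quasiconvex (M l : R) x y :
  0 < M -> N x <= M -> N y <= M -> 0 < l < 1 ->
  N (l *: x + (1 - l) *: y) <= Num.max (N x) (N y)
    - (p - 1) / M / 2 * l * (1 - l) * lpnorm 2 (x - y) ^+ 2.
Proof.
move=> M0 xM yM hl.
apply: (powR_quasiconvex _ _ _ hp M0 _ _ _ _ _ (lpnorm_ge0 _ _ _ _) xM
  (lpnorm_ge0 _ _ _ _) yM (lpnorm_ge0 _ _ _ _) (sqr_ge0 _) hl).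
exact: powR_lpnorm_strongly_convex.
Qed.

(** Strong quasiconvexity with M = 1, its quadratic term dropped; the triangle inequality is derived
    from it without Hölder's inequality. *)
Lemma lpnorm_unit_ball_convex (l : R) x y :
  N x <= 1 -> N y <= 1 -> 0 < l < 1 -> N (l *: x + (1 - l) *: y) <= 1.
Proof.
move=> x1 y1 /[dup] hl /andP[l0 l1].
apply: le_trans (lpnorm_strongly_quasiconvex 1 _ _ _ ltr01 x1 y1 hl) _.
apply: (@le_trans _ _ (Num.max (N x) (N y))); last first.
  by rewrite ge_max; apply/andP; split; [exact: x1|exact: y1].
rewrite gerBl; apply: mulr_ge0; last exact: sqr_ge0.
by rewrite !mulr_ge0 ?invr_ge0 ?subr_ge0// ltW// -subr_gt0.
Qed.

(** (x + y) / (a + b) is the convex combination of x / a and y / b with weight a / (a + b), hence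
    lies in the unit ball. *)
Lemma lpnormD_le (a b : R) x y : 0 < a -> 0 < b -> N x <= a -> N y <= b ->
  N (x + y) <= a + b.
Proof.
move=> a0 b0 xa yb; have ab0 := addr_gt0 a0 b0.
have scaled (c : R) v : 0 < c -> N v <= c -> N (c^-1 *: v) <= 1.
  move=> c0 vc; rewrite lpnormZ// gtr0_norm ?invr_gt0// ler_pdivrMl// mulr1.
  exact: vc.
have hl : 0 < a / (a + b) < 1.
  by rewrite divr_gt0//= ltr_pdivrMr// mul1r ltrDl.
have := lpnorm_unit_ball_convex _ _ _ (scaled _ _ a0 xa) (scaled _ _ b0 yb) hl.
have -> : a / (a + b) *: (a^-1 *: x) + (1 - a / (a + b)) *: (b^-1 *: y)
    = (a + b)^-1 *: (x + y).
  rewrite !scalerA scalerDr; congr (_ *: _ + _ *: _); field.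
    by rewrite !gt_eqF.
  by rewrite !gt_eqF.
by rewrite lpnormZ// gtr0_norm ?invr_gt0// ler_pdivrMl// mulr1.
Qed.

Lemma lpnormD x y : N (x + y) <= N x + N y.
Proof.
have [x0|xn0] := eqVneq (N x) 0.
  by rewrite (lpnorm0_eq0 _ _ _ p0 _ x0) add0r lerDr lpnorm_ge0.
have [y0|yn0] := eqVneq (N y) 0.
  by rewrite (lpnorm0_eq0 _ _ _ p0 _ y0) addr0 lerDl lpnorm_ge0.
have pos v : N v != 0 -> 0 < N v by move=> vn0; rewrite lt0r vn0 lpnorm_ge0.
exact: lpnormD_le (pos _ xn0) (pos _ yn0) (lexx _) (lexx _).
Qed.

Lemma lpnorm_ball_convex (c : 'rV[R]_n) (e : R) :
  convex_set [set x : 'rV[R]_n | N (x - c) < e].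
Proof.
apply/convex_setW => x y /set_mem xe /set_mem ye k k0 k1; apply/mem_set.
change (N (k%:num *: x + (1 - k%:num) *: y - c) < e).
have -> : k%:num *: x + (1 - k%:num) *: y - c
    = k%:num *: (x - c) + (1 - k%:num) *: (y - c).
  by rewrite !scalerBr addrACA -opprD -scalerDl subrKC scale1r.
apply: le_lt_trans (lpnormD _ _) _; rewrite !lpnormZ//.
have k1' : 0 < 1 - k%:num by rewrite subr_gt0.
rewrite (gtr0_norm k0) (gtr0_norm k1').
have -> : e = k%:num * e + (1 - k%:num) * e by ring.
apply: ltrD; first by rewrite (ltr_pM2l k0); exact: xe.
by rewrite (ltr_pM2l k1'); exact: ye.
Qed.

(** The radial projection (r / N x) x attains the infimum; the triangle inequality shows that no
    point of the ball is closer. *)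
Lemma lpdist_lpball (r : R) x : 0 < r -> r <= N x ->
  lpdist p (lpball p r) x = (N x - r)%:E.
Proof.
move=> r0 rx; have x0 : 0 < N x := lt_le_trans r0 rx.
have xn0 : N x != 0 by rewrite gt_eqF.
have q0 : 0 <= r / N x by rewrite divr_ge0 // ltW.
have q1 : 0 <= 1 - r / N x by rewrite subr_ge0 ler_pdivrMr // mul1r.
apply/eqP; rewrite eq_le; apply/andP; split.
  apply: ereal_inf_lbound; exists ((r / N x) *: x).
    by rewrite /lpball /= lpnormZ // (ger0_norm q0) (divfK xn0).
  congr EFin; rewrite -{1}(scale1r x) -scalerBl lpnormZ //.
  by rewrite (ger0_norm q1) mulrBl mul1r (divfK xn0).
apply: le_ereal_inf_tmp => _ [y yr <-]; rewrite lee_fin lerBlDr.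
rewrite -{1}(subrK y x); apply: le_trans (lpnormD _ _) _.
by rewrite lerD2l.
Qed.

End lpnorm_le2.

Theorem theorem3p6 (R : realType) (n : nat) (p r : R)
    (hp : 1 < p <= 2) (hr : 0 < r) (x0 : 'rV[R]_n)
    (hx0 : ~ lpball p r x0) :
  exists (U : set 'rV[R]_n) (sigma : R),
    [/\ nbhs x0 U,
        bounded_set U,
        U `&` lpball p r = set0,
        0 < sigma &
        strongly_quasiconvex sigma U (lpdist p (lpball p r))].
Proof.
have p0 : 0 < p by case/andP: hp => /(lt_trans ltr01).
have rx0 : r < lpnorm p x0 by rewrite ltNge; exact/negP.
(* [e] is the distance from x0 to the ball, so the open p-ball [U] of radius [e] misses the ball,
   and [M] bounds the p-norm on [U]. *)
pose e := lpnorm p x0 - r.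
have e0 : 0 < e by rewrite subr_gt0.
pose M := lpnorm p x0 + e.
have M0 : 0 < M by rewrite addr_gt0// (lt_trans hr).
pose U := [set x : 'rV[R]_n | lpnorm p (x - x0) < e].
have UM x : U x -> lpnorm p x <= M.
  move=> xe; rewrite -(subrK x0 x).
  apply: le_trans (lpnormD _ _ _ hp _ _) _; rewrite /M [leRHS]addrC lerD2r.
  exact: ltW.
have Ur x : U x -> r < lpnorm p x.
  move=> xe; have triangle (a b c : R) : a <= b + c -> b < a - r -> r < c by lra.
  have x0x : lpnorm p (x0 - x) < e.
    by rewrite -opprB (lpnormN _ _ _ p0); exact: xe.
  have := lpnormD _ _ _ hp (x0 - x) x; rewrite subrK => h; exact: triangle h x0x.
have sigma0 : 0 < (p - 1) / M by rewrite divr_gt0// subr_gt0; case/andP: hp.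
have Uconv : convex_set U by exact: lpnorm_ball_convex.
exists U, ((p - 1) / M); split => //.
- exact: nbhs_lpnorm_lt.
- exact: bounded_lpnorm UM.
- by rewrite -subset0 => x [/Ur + /=]; rewrite /lpball /= ltNge => /negP.
split => //.
  by exists x0; rewrite /U /= subrr lpnorm0.
move=> x y l xU yU /[dup] hl /andP[l0 l1].
(* The closed form of the distance is also needed at the intermediate point, which convexity keeps
   outside the ball. *)
have zU : U (l *: x + (1 - l) *: y).
  exact/set_mem/(Uconv _ _ (Itv01 (ltW l0) (ltW l1)) (mem_set xU) (mem_set yU)).
have rN v : U v -> r <= lpnorm p v by move=> /Ur /ltW.
rewrite (lpdist_lpball _ _ _ hp _ _ hr (rN _ zU)).
rewrite (lpdist_lpball _ _ _ hp _ _ hr (rN _ xU)).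
rewrite (lpdist_lpball _ _ _ hp _ _ hr (rN _ yU)).
(* The shift by -r comes out of the maximum and cancels, leaving the inequality for the norm. *)
rewrite -EFin_max -EFinB lee_fin -addr_maxl addrAC lerD2r.
exact: (lpnorm_strongly_quasiconvex _ _ _ hp _ _ _ _ M0 (UM _ xU) (UM _ yU) hl).
Qed.
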